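(* Let $K$ be a field of characteristic $p>0$, let $L\subset K$ be a subfield, and suppose that $K$ has a $p$-basis $x,y$ over $L$. Let $f,g\in K$, and let $a\in K^{\times}$ be an element such that $\partial_{x}(af)+\partial_{y}(ag)=0$. Then, for the derivation $\partial := f\partial_{x}+g\partial_{y}$ of $K$, it holds that \[ a\left(\partial(x)\,\partial^{p}(y)-\partial(y)\,\partial^{p}(x)\right)=f^{p}\,\partial_{x}^{p-1}(ag)-g^{p}\,\partial_{y}^{p-1}(af). \]
   Context: $K^{p}L$ denotes the subfield of $K$ generated by $L$ and the subfield $K^{p}$ of $p$-th powers in $K$. Elements $x,y\in K$ form a $p$-basis of $K$ over $L$ if the $p^{2}$ monomials $x^{i}y^{j}$ with $0\le i,j\le p-1$ form a basis of $K$ as a $K^{p}L$-vector space. In that case $\partial_{x}$ and $\partial_{y}$ denote the unique $L$-linear (equivalently, $K^{p}L$-linear) derivations $K\to K$ with $\partial_{x}(x)=1$, $\partial_{x}(y)=0$, $\partial_{y}(x)=0$, $\partial_{y}(y)=1$. Powers such as $\partial^{p}$, $\partial_{x}^{p-1}$, $\partial_{y}^{p-1}$ denote iterated composition of maps $K\to K$, whereas $f^{p},g^{p}$ are $p$-th powers of elements of $K$. *)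

(* Defs.v *)
From HB Require Import structures.
From mathcomp Require Import all_boot all_algebra.
From mathcomp Require Import boolp classical_sets.
Set Implicit Arguments.
Unset Strict Implicit.
Unset Printing Implicit Defensive.
Import GRing.Theory.
Local Open Scope classical_set_scope.
Local Open Scope ring_scope.

Definition subfield_set (K : fieldType) (S : set K) : Prop :=
  divring_closed (mem S).

(* The subfield K^p L of K generated by L and the p-th powers of K. *)
Definition KpL (K : fieldType) (p : nat) (L : set K) : set K :=
  smallest (@subfield_set K) (L `|` range (fun z : K => z ^+ p)).

Definition monomial_comb (K : fieldType) (p : nat) (x y : K)
    (c : 'I_p -> 'I_p -> K) : K :=
  \sum_(i < p) \sum_(j < p) c i j * (x ^+ i * y ^+ j).

(* K^p L is a set and not a type, so that the monomials x^i y^j, 0 <= i, j < p,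
   form a basis of K over K^p L is spelled out as linear independence over K^p L
   followed by generation. *)
Definition p_basis (K : fieldType) (p : nat) (L : set K) (x y : K) : Prop :=
  (forall c : 'I_p -> 'I_p -> K, (forall i j, KpL p L (c i j)) ->
     monomial_comb x y c = 0 -> forall i j, c i j = 0) /\
  (forall z : K, exists2 c : 'I_p -> 'I_p -> K,
     (forall i j, KpL p L (c i j)) & z = monomial_comb x y c).

Record derivation_over (K : fieldType) (L : set K) (d : K -> K) : Prop :=
  DerivationOver {
    derivation_add : {morph d : u v / u + v};
    derivation_scale : forall c u, L c -> d (c * u) = c * d u;
    derivation_leibniz : forall u v, d (u * v) = d u * v + u * d v
  }.

(* If x, y is a p-basis of K over L, exactly one function d satisfies
   partial_derivation L x y d, namely the partial derivative in x; the partial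
   derivative in y is the one satisfying partial_derivation L y x d. *)
Definition partial_derivation (K : fieldType) (L : set K) (x y : K)
    (d : K -> K) : Prop :=
  [/\ derivation_over L d, d x = 1 & d y = 0].

Definition vector_field (K : fieldType) (dx dy : K -> K) (f g : K) : K -> K :=
  fun z => f * dx z + g * dy z.

(* Main.v *)
(* The hypothesis says that the 1-form w = - a g dx + a f dy is closed, and w
   vanishes on d, while the left-hand side is w(d^p).  Katz's formula for a
   closed form w = A dx + B dy reads
     w(d^p) - d^(p-1) (w(d)) = - f^p dx^(p-1) A - g^p dy^(p-1) B.
   It is linear over the constants of dx and dy, and trivial for w exact because
   dx^p = dy^p = 0, so by Cartier's description of closed forms it reduces to
   w = x^(p-1) dx, that is to
     x^(p-1) d^p x - d^(p-1) (x^(p-1) d x) = (d x)^p.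
   Dividing by the constant x^p and putting u = d x / x, this is
   (d + u)^p (1) = u^p + d^(p-1) u, which follows from the derivative in t of
   (d + t u)^p (1). *)
Require Import Defs.
From HB Require Import structures.
From mathcomp Require Import all_boot all_algebra.
From mathcomp Require Import boolp classical_sets.
From mathcomp Require Import ring.
Set Implicit Arguments.
Unset Strict Implicit.
Unset Printing Implicit Defensive.
Import GRing.Theory.
Local Open Scope classical_set_scope.
Local Open Scope ring_scope.

(** * Elementary rules for derivations *)

Lemma derivation0 (K : fieldType) (L : set K) (d : K -> K) :
  derivation_over L d -> d 0 = 0.
Proof. by case=> dD _ _; apply: (addrI (d 0)); rewrite -dD !addr0. Qed.

Lemma derivationN (K : fieldType) (L : set K) (d : K -> K) :
  derivation_over L d -> {morph d : u / - u}.
Proof.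
move=> dP u; apply: (addrI (d u)).
by rewrite -(derivation_add dP) !subrr (derivation0 dP).
Qed.

Lemma derivationB (K : fieldType) (L : set K) (d : K -> K) :
  derivation_over L d -> {morph d : u v / u - v}.
Proof. by move=> dP u v; rewrite (derivation_add dP) (derivationN dP). Qed.

Lemma derivationMn (K : fieldType) (L : set K) (d : K -> K) (n : nat) (u : K) :
  derivation_over L d -> d (u *+ n) = d u *+ n.
Proof.
move=> dP; elim: n => [|n IHn]; first by rewrite !mulr0n (derivation0 dP).
by rewrite !mulrS (derivation_add dP) IHn.
Qed.

Lemma derivation_sum (K : fieldType) (L : set K) (d : K -> K) (I : Type)
    (r : seq I) (P : pred I) (F : I -> K) :
  derivation_over L d ->
  d (\sum_(i <- r | P i) F i) = \sum_(i <- r | P i) d (F i).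
Proof.
by move=> dP; apply: (big_morph d (derivation_add dP) (derivation0 dP)).
Qed.

Lemma derivation1 (K : fieldType) (L : set K) (d : K -> K) :
  derivation_over L d -> d 1 = 0.
Proof.
move=> dP; apply: (addrI (d 1)); rewrite addr0.
by have := derivation_leibniz dP 1 1; rewrite !mulr1 mul1r => <-.
Qed.

Lemma derivation_nat (K : fieldType) (L : set K) (d : K -> K) (n : nat) :
  derivation_over L d -> d n%:R = 0.
Proof. by move=> dP; rewrite (derivationMn _ _ dP) (derivation1 dP) mul0rn. Qed.

Lemma derivation_in (K : fieldType) (L : set K) (d : K -> K) (c : K) :
  derivation_over L d -> L c -> d c = 0.
Proof.
move=> dP Lc.
by rewrite -[c in LHS]mulr1 (derivation_scale dP) // (derivation1 dP) mulr0.
Qed.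

Lemma derivationZ (K : fieldType) (L : set K) (d : K -> K) (c u : K) :
  derivation_over L d -> d c = 0 -> d (c * u) = c * d u.
Proof. by move=> dP dc; rewrite (derivation_leibniz dP) dc mul0r add0r. Qed.

Lemma derivationV (K : fieldType) (L : set K) (d : K -> K) (c : K) :
  derivation_over L d -> d c = 0 -> d c^-1 = 0.
Proof.
move=> dP dc; have [->|c0] := eqVneq c 0; first by rewrite invr0 (derivation0 dP).
apply: (mulfI c0).
by rewrite -(derivationZ _ dP dc) mulfV // (derivation1 dP) mulr0.
Qed.

Lemma derivationX (K : fieldType) (L : set K) (d : K -> K) (n : nat) (u : K) :
  derivation_over L d -> d (u ^+ n) = n%:R * u ^+ n.-1 * d u.
Proof.
move=> dP; elim: n => [|[|n] IHn].
- by rewrite expr0 (derivation1 dP) !mul0r.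
- by rewrite /= expr1 expr0 !mul1r.
- rewrite exprS (derivation_leibniz dP) IHn /= !exprS -!natr1; ring.
Qed.

Lemma derivation_pchar (K : fieldType) (p : nat) (L : set K) (d : K -> K)
    (u : K) :
  p \in [pchar K] -> derivation_over L d -> d (u ^+ p) = 0.
Proof. by move=> chp dP; rewrite (derivationX _ _ dP) pcharf0 // !mul0r. Qed.

(** * Iterates, differences, commutators and combinations of derivations *)

Lemma iter_derivation0 (K : fieldType) (L : set K) (d : K -> K) (n : nat) :
  derivation_over L d -> iter n d 0 = 0.
Proof. by move=> dP; elim: n => //= n ->; rewrite (derivation0 dP). Qed.

Lemma iter_derivationD (K : fieldType) (L : set K) (d : K -> K) (n : nat) :
  derivation_over L d -> {morph iter n d : u v / u + v}.
Proof.
by move=> dP u v; elim: n => //= n ->; rewrite (derivation_add dP).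
Qed.

Lemma iter_derivationZ (K : fieldType) (L : set K) (d : K -> K) (n : nat)
    (c u : K) :
  derivation_over L d -> d c = 0 -> iter n d (c * u) = c * iter n d u.
Proof.
by move=> dP dc; elim: n => //= n ->; rewrite (derivationZ _ dP dc).
Qed.

Lemma iter_derivationN (K : fieldType) (L : set K) (d : K -> K) (n : nat) :
  derivation_over L d -> {morph iter n d : u / - u}.
Proof.
by move=> dP u; elim: n => //= n ->; rewrite (derivationN dP).
Qed.

Lemma iter_derivationM (K : fieldType) (L : set K) (d : K -> K) (n : nat)
    (u v : K) :
  derivation_over L d ->
  iter n d (u * v) =
  \sum_(i < n.+1) (iter i d u * iter (n - i) d v) *+ 'C(n, i).
Proof.
move=> dP; elim: n => [|n IHn]; first by rewrite big_ord_recl big_ord0 addr0.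
rewrite iterS IHn (derivation_sum _ _ _ dP).
under eq_bigr => i _.
  rewrite (derivationMn _ _ dP) (derivation_leibniz dP) mulrnDl -!iterS.
  rewrite -subSn; last by rewrite -ltnS.
  over.
rewrite big_split /= addrC [RHS]big_ord_recl [in LHS]big_ord_recl /=.
rewrite !bin0 -addrA; congr (_ + _).
under [RHS]eq_bigr => i _ do rewrite /bump leq0n add1n binS mulrnDr subSS.
rewrite big_split /=; congr (_ + _).
rewrite [RHS]big_ord_recr /= bin_small // mulr0n addr0.
by apply: eq_bigr => i _; rewrite subSS.
Qed.

(** In the Leibniz formula of order p, all binomial coefficients except the two outer ones are
    divisible by p. *)
Lemma iter_pchar_derivation (K : fieldType) (p : nat) (L : set K)
    (d : K -> K) :
  p \in [pchar K] -> derivation_over L d -> derivation_over L (iter p d).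
Proof.
move=> chp dP; split=> [u v|c u Lc|u v].
- exact: iter_derivationD dP u v.
- exact: iter_derivationZ dP (derivation_in dP Lc).
have p_pr := pcharf_prime chp.
case: p p_pr chp => // p p_pr chp.
rewrite (iter_derivationM _ _ _ dP) big_ord_recl big_ord_recr /= big1 => [|i _].
  by rewrite add0r /bump leq0n add1n subnn ?subn0 bin0 binn addrC.
rewrite /bump leq0n add1n -mulr_natr.
have /dvdnP[k ->] : (p.+1 %| 'C(p.+1, i.+1))%N.
  by rewrite prime_dvd_bin //= ltnS.
by rewrite natrM (pcharf0 chp) !mulr0.
Qed.

Lemma sub_derivation (K : fieldType) (L : set K) (d e : K -> K) :
  derivation_over L d -> derivation_over L e ->
  derivation_over L (fun u => d u - e u).
Proof.
move=> dP eP; split=> [u v|c u Lc|u v].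
- rewrite (derivation_add dP) (derivation_add eP); ring.
- rewrite (derivation_scale dP) // (derivation_scale eP) //; ring.
- rewrite (derivation_leibniz dP) (derivation_leibniz eP); ring.
Qed.

Lemma commutator_derivation (K : fieldType) (L : set K) (d e : K -> K) :
  derivation_over L d -> derivation_over L e ->
  derivation_over L (fun u => d (e u) - e (d u)).
Proof.
move=> dP eP; split=> [u v|c u Lc|u v].
- rewrite (derivation_add eP) (derivation_add dP).
  rewrite (derivation_add dP) (derivation_add eP); ring.
- do 2!rewrite (derivation_scale dP) // (derivation_scale eP) //.
  by rewrite mulrBr.
- rewrite (derivation_leibniz dP u) (derivation_leibniz eP u).
  rewrite (derivation_add dP) (derivation_add eP).
  rewrite !(derivation_leibniz dP) !(derivation_leibniz eP); ring.
Qed.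

Lemma vector_field_derivation (K : fieldType) (L : set K) (d e : K -> K)
    (f g : K) :
  derivation_over L d -> derivation_over L e ->
  derivation_over L (vector_field d e f g).
Proof.
move=> dP eP; rewrite /vector_field; split=> [u v|c u Lc|u v].
- rewrite (derivation_add dP) (derivation_add eP); ring.
- rewrite (derivation_scale dP) // (derivation_scale eP) //; ring.
- rewrite (derivation_leibniz dP) (derivation_leibniz eP); ring.
Qed.

(** * Derivations of a field with a p-basis *)

(** The kernel of [d] is a subfield containing [L] and all p-th powers, hence K^p L; so [d] is
    linear over K^p L, and it kills the monomials in [x] and [y]. *)
Lemma derivation_eq0 (K : fieldType) (p : nat) (L : set K) (x y : K)
    (d : K -> K) :
  p \in [pchar K] -> p_basis p L x y -> derivation_over L d ->
  d x = 0 -> d y = 0 -> forall z, d z = 0.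
Proof.
move=> chp [_ gen_xy] dP dx0 dy0 z.
have KpL0 c : KpL p L c -> d c = 0.
  (* [smallest] is an intersection, so [Kc] can be applied to the kernel of [d]. *)
  move=> Kc; have : [set u | d u = 0] c; last by [].
  apply: Kc; split.
    split; first by rewrite inE /= (derivation1 dP).
      move=> u v; rewrite !inE /= => du dv.
      by rewrite (derivationB dP) du dv subrr.
    move=> u v; rewrite !inE /= => du dv.
    by rewrite (derivationZ _ dP du) (derivationV dP dv) mulr0.
  move=> u [Lu|[v _ <-]] /=; first exact: derivation_in dP Lu.
  exact: derivation_pchar chp dP.
have [c Kc ->] := gen_xy z.
rewrite (derivation_sum _ _ _ dP) big1 // => i _.
rewrite (derivation_sum _ _ _ dP) big1 // => j _.
rewrite (derivationZ _ dP (KpL0 _ (Kc i j))) (derivation_leibniz dP).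
by rewrite !(derivationX _ _ dP) dx0 dy0 !(mulr0, mul0r) addr0 mulr0.
Qed.

(** The difference of the two sides is a derivation that kills [x] and [y]. *)
Lemma derivation_partialE (K : fieldType) (p : nat) (L : set K) (x y : K)
    (dx dy e : K -> K) :
  p \in [pchar K] -> p_basis p L x y ->
  partial_derivation L x y dx -> partial_derivation L y x dy ->
  derivation_over L e -> forall u, e u = dx u * e x + dy u * e y.
Proof.
move=> chp basis_xy [dxP dxx dxy] [dyP dyy dyx] eP u.
have fieldP := vector_field_derivation (e x) (e y) dxP dyP.
have /= := derivation_eq0 chp basis_xy (sub_derivation eP fieldP).
rewrite /vector_field dxx dxy dyx dyy !mulr1 !mulr0 addr0 add0r !subrr.
move=> /(_ erefl erefl u) /eqP; rewrite subr_eq0 => /eqP ->.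
by rewrite ![_ * e _]mulrC.
Qed.

(** * The p-th iterate and logarithmic derivatives *)

(* [shift_coef d u n i] is the coefficient of t^i in (d + t u)^n (1), computed
   in K[t]. *)
Fixpoint shift_coef (K : fieldType) (d : K -> K) (u : K) (n i : nat) : K :=
  if n is m.+1 then
    d (shift_coef d u m i) + (if i is j.+1 then u * shift_coef d u m j else 0)
  else (i == 0%N)%:R.

Lemma shift_coef_gt (K : fieldType) (L : set K) (d : K -> K) (u : K)
    (n i : nat) :
  derivation_over L d -> (n < i)%N -> shift_coef d u n i = 0.
Proof.
move=> dP; elim: n i => [|n IHn] [|i] //= lt_ni.
by rewrite !IHn ?(ltnW lt_ni) // mulr0 (derivation0 dP) addr0.
Qed.

(** The power t^n arises only from choosing t u in each of the n factors. *)
Lemma shift_coef_diag (K : fieldType) (L : set K) (d : K -> K) (u : K)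
    (n : nat) :
  derivation_over L d -> shift_coef d u n n = u ^+ n.
Proof.
move=> dP; elim: n => [|n IHn] //=.
by rewrite (shift_coef_gt _ dP) // (derivation0 dP) add0r IHn exprS.
Qed.

(** Setting t = 0 leaves d^(n+1) (1). *)
Lemma shift_coef0 (K : fieldType) (L : set K) (d : K -> K) (u : K) (n : nat) :
  derivation_over L d -> shift_coef d u n.+1 0 = 0.
Proof.
move=> dP; elim: n => [|n IHn].
  by rewrite /= (derivation1 dP) addr0.
by rewrite /= in IHn *; rewrite IHn (derivation0 dP) addr0.
Qed.

(* d + d z / z is the conjugate of d by multiplication by z. *)
Lemma iter_derivation_shift_coef (K : fieldType) (L : set K) (d : K -> K)
    (z : K) (n : nat) :
  derivation_over L d -> z != 0 ->
  iter n d z = z * \sum_(i < n.+1) shift_coef d (d z / z) n i.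
Proof.
move=> dP z0; elim: n => [|n IHn]; first by rewrite big_ord1 mulr1.
rewrite iterS IHn (derivation_leibniz dP) (derivation_sum _ _ _ dP).
rewrite /= big_split /= [X in _ = _ * (X + _)]big_ord_recr /=.
(* The top index exceeds the degree in t of (d + t u)^n (1). *)
rewrite (shift_coef_gt _ dP) // (derivation0 dP) addr0.
rewrite [X in _ = _ * (_ + X)]big_ord_recl /= add0r -mulr_sumr.
by rewrite mulrDr addrC [X in _ = _ + X]mulrA [z * (_ / z)]mulrC divfK.
Qed.

(* The derivative in t of (d + t u)^n (1). *)
Lemma shift_coef_deriv (K : fieldType) (L : set K) (d : K -> K) (u : K)
    (n i : nat) :
  derivation_over L d ->
  shift_coef d u n i.+1 *+ i.+1 =
  \sum_(k < n) (iter k d u * shift_coef d u (n - k.+1) i) *+ 'C(n, k.+1).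
Proof.
move=> dP; elim: n i => [|n IHn] i; first by rewrite big_ord0 /= mul0rn.
rewrite /= mulrnDl -(derivationMn _ _ dP) IHn (derivation_sum _ _ _ dP).
under [RHS]eq_bigr => k _ do rewrite binS mulrnDr subSS.
rewrite big_split /= big_ord_recr /= bin_small // mulr0n addr0.
rewrite [X in _ = _ + X]big_ord_recl /= bin0 subn0 mulr1n.
under eq_bigr => k _.
  rewrite (derivationMn _ _ dP) (derivation_leibniz dP) mulrnDl -iterS.
  over.
rewrite big_split /=.
under [X in _ = X + _]eq_bigr => k _.
  rewrite (_ : n - k = (n - k.+1).+1)%N; last by rewrite subnSK.
  rewrite /= mulrDr mulrnDl; over.
rewrite big_split /= mulrS.
under [X in _ = _ + (_ + X)]eq_bigr => k _ do rewrite /bump leq0n add1n.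
(* What remains is the coefficient of t^i in t u times the derivative of (d + t u)^n (1): the
   induction hypothesis one index lower, and zero for [i = 0]. *)
suff -> : \sum_(k < n) (iter k d u *
    (if i is j.+1 then u * shift_coef d u (n - k.+1) j else 0)) *+ 'C(n, k.+1)
    = u * shift_coef d u n i *+ i by ring.
case: i => [|i]; first by rewrite mulr0n big1 // => k _; rewrite mulr0 mul0rn.
rewrite -mulrnAr IHn mulr_sumr; apply: eq_bigr => k _.
by rewrite mulrCA mulrnAr.
Qed.

(** Modulo p, the derivative in t of (d + t u)^p (1) keeps only the summand k = p - 1, which is the
    constant d^(p-1) u. As i + 1 is invertible below p, only the coefficients of t and t^p survive;
    then t = 1. *)
Lemma iter_pchar_derivation_div (K : fieldType) (p : nat) (L : set K)
    (d : K -> K) (z : K) :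
  p \in [pchar K] -> derivation_over L d -> z != 0 ->
  iter p d z / z = (d z / z) ^+ p + iter p.-1 d (d z / z).
Proof.
move=> chp dP z0; set u := d z / z.
have p_pr := pcharf_prime chp.
have coefE i : (i.+1 < p)%N ->
    shift_coef d u p i.+1 = if i == 0%N then iter p.-1 d u else 0.
  move=> lt_ip; have i1 : (i.+1%:R : K) != 0.
    by rewrite -(dvdn_pcharf chp) gtnNdvd.
  apply: (mulIf i1); rewrite mulr_natr (shift_coef_deriv _ _ _ dP).
  case: p {p_pr} (p_pr) chp lt_ip => // q q_pr chq lt_iq.
  rewrite big_ord_recr /= big1 ?add0r => [|k _].
    rewrite subnn binn mulr1n /=; case: eqVneq => [->|]; last by rewrite mulr0 mul0r.
    by [].
  rewrite -mulr_natr.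
  have /dvdnP[m ->] : (q.+1 %| 'C(q.+1, k.+1))%N.
    by rewrite prime_dvd_bin //= ltnS.
  by rewrite natrM (pcharf0 chq) !mulr0.
rewrite (iter_derivation_shift_coef _ dP z0) mulrC mulKf // -/u.
(* As p >= 2, the indices 0, 1 and p are distinct and can be split off. *)
case: p p_pr chp coefE => [|[|p]] // p_pr chp coefE.
rewrite big_ord_recr big_ord_recl big_ord_recl.
rewrite (shift_coef0 _ _ dP) (shift_coef_diag _ _ dP) (coefE 0%N) //.
rewrite big1 => [|i _]; first by rewrite [LHS]/= add0r addr0 addrC.
by rewrite coefE //= /bump !leq0n !add1n !ltnS.
Qed.

(** The p-th power of [z] is a constant of [d], so z^(p-1) = z^p / z reduces this to the logarithmic
    derivative. *)
Lemma iter_pchar_derivation_expr (K : fieldType) (p : nat) (L : set K)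
    (d : K -> K) (z : K) :
  p \in [pchar K] -> derivation_over L d -> z != 0 ->
  z ^+ p.-1 * iter p d z - iter p.-1 d (z ^+ p.-1 * d z) = d z ^+ p.
Proof.
move=> chp dP z0; have p_gt0 := prime_gt0 (pcharf_prime chp).
have zE : z ^+ p.-1 = z ^+ p / z by rewrite -(prednK p_gt0) exprSr mulfK.
rewrite zE -!mulrA [z^-1 * d z]mulrC [z^-1 * iter p d z]mulrC.
rewrite (iter_derivationZ _ _ dP (derivation_pchar _ chp dP)).
rewrite (iter_pchar_derivation_div chp dP z0) -mulrBr addrK.
by rewrite expr_div_n mulrC divfK // expf_neq0.
Qed.

(** * Integration by parts in characteristic p *)

(* Repeated integration by parts, stopped before p divides a factorial. *)
Definition truncated_primitive (K : fieldType) (p : nat) (d : K -> K)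
    (x A : K) : K :=
  \sum_(k < p.-1) (-1) ^+ k * (x ^+ k.+1 / (k.+1)`!%:R) * iter k d A.

Lemma fact_pchar_neq0 (K : fieldType) (p k : nat) :
  p \in [pchar K] -> (k < p)%N -> (k`!%:R : K) != 0.
Proof.
move=> chp; elim: k => [|k IHk] lt_kp; first by rewrite oner_neq0.
rewrite factS natrM mulf_neq0 ?IHk ?(ltnW lt_kp) //.
by rewrite -(dvdn_pcharf chp) gtnNdvd.
Qed.

Lemma fact_pred_pchar (K : fieldType) (p : nat) :
  p \in [pchar K] -> ((p.-1)`!%:R : K) = -1.
Proof.
move=> chp; have p_pr := pcharf_prime chp.
apply/eqP; rewrite -subr_eq0 opprK natr1 -(dvdn_pcharf chp).
by rewrite -Wilson // prime_gt1.
Qed.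

(** Additivity of the Frobenius covers p = 2 and odd p alike. *)
Lemma signr_pchar (K : fieldType) (p : nat) :
  p \in [pchar K] -> (-1) ^+ p.-1 = 1 :> K.
Proof.
move=> chp; have := pFrobenius_autN chp 1.
rewrite !pFrobenius_autE expr1n -[in _ ^+ p](prednK (prime_gt0 (pcharf_prime chp))).
by rewrite exprS mulN1r => /oppr_inj.
Qed.

Lemma derivation_truncated_primitive (K : fieldType) (p : nat) (L : set K)
    (d : K -> K) (x A : K) :
  p \in [pchar K] -> derivation_over L d -> d x = 1 ->
  d (truncated_primitive p d x A) = A + x ^+ p.-1 * iter p.-1 d A.
Proof.
move=> chp dP dx1; have p_gt0 := prime_gt0 (pcharf_prime chp).
pose T k := - ((-1) ^+ k * (x ^+ k / k`!%:R) * iter k d A).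
have step k : (k < p.-1)%N ->
    d ((-1) ^+ k * (x ^+ k.+1 / (k.+1)`!%:R) * iter k d A) = T k.+1 - T k.
  move=> lt_k; have lt_kp : (k.+1 < p)%N by rewrite -(prednK p_gt0).
  have k1 : (k.+1%:R : K) != 0 by rewrite -(dvdn_pcharf chp) gtnNdvd.
  have kf := fact_pchar_neq0 chp (ltnW lt_kp).
  have s0 : d ((-1) ^+ k) = 0.
    by rewrite (derivationX _ _ dP) (derivationN dP) (derivation1 dP) oppr0 mulr0.
  have f0 : d (k.+1)`!%:R^-1 = 0.
    exact: derivationV dP (derivation_nat _ dP).
  rewrite -mulrA (derivationZ _ dP s0) (derivation_leibniz dP).
  rewrite [x ^+ _ / _]mulrC (derivationZ _ dP f0) (derivationX _ _ dP) dx1.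
  rewrite /T /= factS natrM !exprS; field.
  by rewrite kf addrC natr1 k1.
rewrite /truncated_primitive (derivation_sum _ _ _ dP).
under eq_bigr => k _ do rewrite step //.
(* [- T 0] is [A]; in [T p.-1] the sign cancels against (p-1)! = -1, by Wilson. *)
rewrite -(big_mkord xpredT (fun k => T k.+1 - T k)) telescope_sumr // /T /=.
rewrite !expr0 fact0 invr1 (fact_pred_pchar chp) (signr_pchar chp) invrN1; ring.
Qed.

(** * Katz's formula and the theorem *)

(* Katz's formula for a closed form A dx + B dy.  Up to the differential of
   F + G, such a form is a combination of x^(p-1) dx and y^(p-1) dy with
   coefficients killed by both partial derivatives. *)
Lemma closed_form_iter_pchar (K : fieldType) (p : nat) (L : set K) (x y : K)
    (dx dy : K -> K) (f g A B : K) :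
  p \in [pchar K] -> p_basis p L x y ->
  partial_derivation L x y dx -> partial_derivation L y x dy ->
  dy A = dx B ->
  let d := vector_field dx dy f g in
  A * iter p d x + B * iter p d y - iter p.-1 d (A * f + B * g) =
  - (f ^+ p * iter p.-1 dx A + g ^+ p * iter p.-1 dy B).
Proof.
move=> chp basis_xy [dxP dxx dxy] [dyP dyy dyx] closedAB d.
have p_gt0 := prime_gt0 (pcharf_prime chp).
have dP : derivation_over L d := vector_field_derivation f g dxP dyP.
have x0 : x != 0.
  by apply: contra_eq_neq dxx => ->; rewrite (derivation0 dxP) eq_sym oner_neq0.
have y0 : y != 0.
  by apply: contra_eq_neq dyy => ->; rewrite (derivation0 dyP) eq_sym oner_neq0.
have vanish e (eP : derivation_over L e) := derivation_eq0 chp basis_xy eP.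
have dxdyC u : dx (dy u) = dy (dx u).
  apply/eqP; rewrite -subr_eq0; apply/eqP.
  apply: (vanish _ (commutator_derivation dxP dyP)).
  - by rewrite dyx dxx (derivation0 dxP) (derivation1 dyP) subrr.
  - by rewrite dyy dxy (derivation0 dyP) (derivation1 dxP) subrr.
have iter_dxdyC n u : iter n dx (dy u) = dy (iter n dx u).
  by elim: n => //= n ->.
have iter_dydxC n u : iter n dy (dx u) = dx (iter n dy u).
  by elim: n => //= n ->.
have iterS2 e u n : iter n.+2 e u = iter n e (e (e u)) by rewrite !iterSr.
have p_gt1 := prime_gt1 (pcharf_prime chp).
(* The p-th iterate is a derivation, and it kills [x] and [y] already after two steps. *)
have dxp0 u : iter p dx u = 0.
  apply: (vanish _ (iter_pchar_derivation chp dxP)); rewrite -(subnK p_gt1) addn2 iterS2.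
    by rewrite dxx (derivation1 dxP) (iter_derivation0 _ dxP).
  by rewrite dxy (derivation0 dxP) (iter_derivation0 _ dxP).
have dyp0 u : iter p dy u = 0.
  apply: (vanish _ (iter_pchar_derivation chp dyP)); rewrite -(subnK p_gt1) addn2 iterS2.
    by rewrite dyx (derivation0 dyP) (iter_derivation0 _ dyP).
  by rewrite dyy (derivation1 dyP) (iter_derivation0 _ dyP).
(* Both are constants for [dx] and [dy]: one way by dx^p = dy^p = 0, the other because closedness
   turns dy dx^(p-1) A into dx^p B, and symmetrically. *)
set al := iter p.-1 dx A; set be := iter p.-1 dy B.
have dx_al : dx al = 0 by rewrite -iterS (prednK p_gt0).
have dy_be : dy be = 0 by rewrite -iterS (prednK p_gt0).
have dy_al : dy al = 0.
  by rewrite -iter_dxdyC closedAB -iterSr (prednK p_gt0).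
have dx_be : dx be = 0.
  by rewrite -iter_dydxC -closedAB -iterSr (prednK p_gt0).
have dal : d al = 0 by rewrite /d /vector_field dx_al dy_al !mulr0 addr0.
have dbe : d be = 0 by rewrite /d /vector_field dx_be dy_be !mulr0 addr0.
have dXx : d x = f by rewrite /d /vector_field dxx dyx mulr1 mulr0 addr0.
have dXy : d y = g by rewrite /d /vector_field dxy dyy mulr1 mulr0 add0r.
pose F := truncated_primitive p dx x A.
have dxF : dx F = A + x ^+ p.-1 * al := derivation_truncated_primitive A chp dxP dxx.
(* What is left of [B] depends on [y] alone, so integrating it in [y] to get [G] leaves [dx F]
   unchanged. *)
pose B' := B - dy F.
have dxB' : dx B' = 0.
  rewrite (derivationB dxP) dxdyC dxF (derivation_add dyP).
  rewrite [x ^+ _ * _]mulrC (derivationZ _ dyP dy_al) (derivationX _ _ dyP) dyx.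
  by rewrite !mulr0 addr0 closedAB subrr.
have beE : iter p.-1 dy B' = be.
  rewrite (iter_derivationD _ dyP) (iter_derivationN _ dyP) -iterSr.
  by rewrite (prednK p_gt0) dyp0 subr0.
pose G := truncated_primitive p dy y B'.
have dyG : dy G = B' + y ^+ p.-1 * be.
  by rewrite -beE; apply: derivation_truncated_primitive chp dyP dyy.
have dxG : dx G = 0.
  rewrite (derivation_sum _ _ _ dxP) big1 // => k _.
  rewrite (derivation_leibniz dxP) -iter_dydxC dxB' (iter_derivation0 _ dyP).
  rewrite !(derivation_leibniz dxP) !(derivationX _ _ dxP) dxy.
  rewrite (derivationN dxP) (derivation1 dxP).
  by rewrite (derivationV dxP (derivation_nat _ dxP)) oppr0 !(mulr0, mul0r, addr0).
have AE : A = dx (F + G) - al * x ^+ p.-1.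
  by rewrite (derivation_add dxP) dxF dxG; ring.
have BE : B = dy (F + G) - be * y ^+ p.-1.
  by rewrite (derivation_add dyP) dyG /B'; ring.
(* For the exact form of F + G, contraction with d^p gives d^p (F + G), which cancels against
   d^(p-1) (d (F + G)). *)
have iter_pE u : iter p d u = dx u * iter p d x + dy u * iter p d y.
  apply: (derivation_partialE chp basis_xy) => //; exact: iter_pchar_derivation.
have contractE : A * f + B * g =
    d (F + G) - (al * (x ^+ p.-1 * d x) + be * (y ^+ p.-1 * d y)).
  by rewrite dXx dXy {1}AE {1}BE /d /vector_field; ring.
rewrite contractE (iter_derivationD _ dP) -iterSr (prednK p_gt0).
rewrite (iter_pE (F + G)) (iter_derivationN _ dP) (iter_derivationD _ dP).
rewrite (iter_derivationZ _ _ dP dal) (iter_derivationZ _ _ dP dbe).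
rewrite {1}AE {1}BE -{1}dXx -{1}dXy.
rewrite -(iter_pchar_derivation_expr chp dP x0).
rewrite -(iter_pchar_derivation_expr chp dP y0); ring.
Qed.

Theorem theorem3 (K : fieldType) (p : nat) (charKp : p \in [pchar K])
    (L : set K) (subfieldL : subfield_set L)
    (x y : K) (basis_xy : p_basis p L x y)
    (dx : K -> K) (dxP : partial_derivation L x y dx)
    (dy : K -> K) (dyP : partial_derivation L y x dy)
    (f g a : K) (a_neq0 : a != 0)
    (div_free : dx (a * f) + dy (a * g) = 0) :
  let d := vector_field dx dy f g in
  a * (d x * iter p d y - d y * iter p d x) =
  f ^+ p * iter p.-1 dx (a * g) - g ^+ p * iter p.-1 dy (a * f).
Proof.
move=> d; have [dxD dxx dxy] := dxP; have [dyD dyy dyx] := dyP.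
(* Katz's formula is used with A = - a g and B = a f; [div_free] is closedness. *)
have closed : dy (- (a * g)) = dx (a * f).
  by apply/eqP; rewrite (derivationN dyD) eq_sym -addr_eq0 div_free.
have dP : derivation_over L d := vector_field_derivation f g dxD dyD.
have := closed_form_iter_pchar f g charKp basis_xy dxP dyP closed.
rewrite -/d /= (iter_derivationN _ dxD).
rewrite (_ : - (a * g) * f + a * f * g = 0); last by ring.
rewrite (iter_derivation0 _ dP) subr0 => dE.
have -> : d x = f by rewrite /d /vector_field dxx dyx mulr1 mulr0 addr0.
have -> : d y = g by rewrite /d /vector_field dxy dyy mulr1 mulr0 add0r.
transitivity (- (a * g) * iter p d x + a * f * iter p d y); first by ring.
by rewrite dE; ring.
Qed.
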